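(* Let $d\ge 2$ and let $P$ be a $d$-SMP. If $\mathrm{rank}(P)=\infty$, then $P$ is strongly unavoidable. If $\mathrm{rank}(P)<\infty$, then $P$ is avoidable.
   Context: A $d$-dimensional permutation $\Pi$ of length $n\ge 1$ is an ordered $(d-1)$-tuple $(\pi^2,\dots,\pi^d)$ of permutations of $\{1,\dots,n\}$, with $\pi^i=\pi^i_1\cdots\pi^i_n$; set $\pi^1=12\cdots n$. Its elements are the $d$-tuples $\Pi_j=(\pi^1_j,\pi^2_j,\dots,\pi^d_j)^T$, $1\le j\le n$, and one writes $\Pi=\Pi_1\cdots\Pi_n$. A $d$-dimensional singleton mesh pattern ($d$-SMP) $P$ is a set of $d$-tuples in $\{+,-\}^d$. Its elements are the columns of the matrix $T(P)$, which has $d$ rows; its cardinality is $|P|$. For $i\ne j$, $\mathrm{sign}(\Pi_j-\Pi_i)\in\{+,-\}^d$ denotes the tuple of componentwise signs. The element $\Pi_i$ is an occurrence of $P$ if there is no $j\neq i$ with $\mathrm{sign}(\Pi_j-\Pi_i)\in P$. $\Pi$ avoids $P$ if no element of $\Pi$ is an occurrence of $P$. $P$ is avoidable if there exist arbitrarily long $d$-dimensional permutations avoiding $P$. $P$ is strongly unavoidable if every $d$-dimensional permutation (of length $\geq 1$) has an occurrence of $P$. The rank of $P$, $\mathrm{rank}(P)$, is the minimum cardinality of a $P'\subseteq P$ such that every row of $T(P')$ contains both a $+$ and a $-$; if no such $P'$ exists (that is, some row of $T(P)$ does not contain both signs), $\mathrm{rank}(P)=\infty$. *)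

(* Defs.v *)
From mathcomp Require Import all_boot all_fingroup.

Set Implicit Arguments.
Unset Strict Implicit.
Unset Printing Implicit Defensive.

(* The tuple (pi^2, ..., pi^d); positions and values are 0-based, i.e. in
   {0, ..., n-1} rather than {1, ..., n}. *)
Definition dperm (d n : nat) := (d.-1).-tuple 'S_n.

(* Row k of Pi, with k 0-based: row 0 is pi^1 = id, which is not stored. *)
Definition dperm_row (d n : nat) (Pi : dperm d n) (k : 'I_d) : 'S_n :=
  nth 1%g (1%g :: Pi) k.

Definition dperm_elt (d n : nat) (Pi : dperm d n) (j : 'I_n) :
    {ffun 'I_d -> 'I_n} :=
  [ffun k => dperm_row Pi k j].

(* Elements of {+,-}^d: true stands for + and false for -. *)
Definition signs (d : nat) := {ffun 'I_d -> bool}.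

Definition smp (d : nat) := {set signs d}.

(* sign (y - x); distinct elements of a d-dimensional permutation differ in
   every coordinate, so false does mean - there. *)
Definition sign_diff (d n : nat) (y x : {ffun 'I_d -> 'I_n}) : signs d :=
  [ffun k => x k < y k].

Definition occurrence (d n : nat) (P : smp d) (Pi : dperm d n) (i : 'I_n) :
    bool :=
  ~~ [exists j, (j != i) && (sign_diff (dperm_elt Pi j) (dperm_elt Pi i) \in P)].

Definition avoids (d n : nat) (P : smp d) (Pi : dperm d n) : bool :=
  ~~ [exists i, occurrence P Pi i].

Definition avoidable (d : nat) (P : smp d) : Prop :=
  forall N : nat, exists2 n : nat, N < n & exists Pi : dperm d n, avoids P Pi.

Definition strongly_unavoidable (d : nat) (P : smp d) : Prop :=
  forall n : nat, 0 < n -> forall Pi : dperm d n, exists i, occurrence P Pi i.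

Definition rows_have_both_signs (d : nat) (Q : smp d) : bool :=
  [forall k : 'I_d, [exists p in Q, p k] && [exists q in Q, ~~ q k]].

(* None stands for infinity. *)
Definition rank (d : nat) (P : smp d) : option nat :=
  if [pick Q : smp d | (Q \subset P) && rows_have_both_signs Q] is Some Q0 then
    Some #|[arg min_(Q < Q0 | (Q \subset P) && rows_have_both_signs Q) #|Q|]|
  else None.

(* Main.v *)
Require Import Defs.
From mathcomp Require Import all_boot all_fingroup.
From mathcomp Require Import zify.

(** The rank is finite exactly when every row of T(P) contains both signs, so
    only that property of P matters.

    If some row k misses a sign, an extremal element in row k is an occurrence:
    when no tuple of P has a + in row k, every other element lies above the
    lowest one in that row, so no difference from it has its sign in P; when -
    is missing the highest element works in the same way.

    If every row has both signs, choose a closed walk of length n whose steps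
    list all the sign tuples of P, with repetitions: n can be as large as one
    likes.  The points x_0, ..., x_(n-1) visited by the walk should satisfy
    sign (x_(t+1) - x_t) = c_t with c_t in P, indices being taken modulo n; then
    the successor of each point shows that it is no occurrence.  The rows can be
    treated independently, and in one row the problem is to find a cyclic
    arrangement of n distinct heights with prescribed ups and downs, not all
    equal ([cyclic_ups_downs]).  With p ups among the n steps, rises of n - p
    and falls of p do bring the walk back to its starting height; ties between
    non-consecutive points are broken by their index, and the heights are then
    replaced by their ranks ([perm_of_ranking]).  Finally the points are
    re-indexed by their first coordinate, which makes row 0 the identity
    ([dperm_of_rows]). *)

Lemma rows_have_both_signsS (d : nat) (Q P : smp d) :
  Q \subset P -> rows_have_both_signs Q -> rows_have_both_signs P.
Proof.
move=> /subsetP QP /forallP bothQ; apply/forallP => k.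
have /andP[/exists_inP[p Qp pk] /exists_inP[q Qq qk]] := bothQ k.
by apply/andP; split; apply/exists_inP; [exists p | exists q] => //; apply: QP.
Qed.

Lemma rank_finite (d : nat) (P : smp d) :
  rank P = rows_have_both_signs P :> bool.
Proof.
rewrite /rank; case: pickP => [Q /andP[QP bothQ] | noQ] /=.
  by rewrite (rows_have_both_signsS _ _ _ QP bothQ).
by have := noQ P; rewrite subxx.
Qed.

Lemma strongly_unavoidable_missing_sign (d : nat) (P : smp d) :
  ~~ rows_have_both_signs P -> strongly_unavoidable P.
Proof.
rewrite negb_forall => /existsP[k]; rewrite negb_and => missing [//|n] _ Pi.
set s := dperm_row Pi k.
case/orP: missing => /exists_inPn missing.
- exists ((s^-1)%g ord0); apply/existsPn => j; apply/negP => /andP[j_neq /missing].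
  rewrite !ffunE -/s permKV /= lt0n negbK => /eqP sj0; case/eqP: j_neq.
  by apply: (@perm_inj _ s); rewrite permKV; apply: val_inj.
- exists ((s^-1)%g ord_max); apply/existsPn => j; apply/negP => /andP[_ /missing].
  by rewrite !ffunE -/s permKV negbK ltnNge -ltnS ltn_ord.
Qed.

Lemma perm_of_ranking (n : nat) (f : 'I_n -> nat) :
  injective f -> exists s : 'S_n, forall t u, f t < f u -> s t < s u.
Proof.
move=> f_inj; pose below t := [set v | f v < f t].
have below_lt t : #|below t| < n.
  rewrite -[X in _ < X]card_ord -cardsT; apply: proper_card.
  by rewrite properT; apply/eqP => /setP/(_ t); rewrite !inE ltnn.
have rank_lt t u : f t < f u -> #|below t| < #|below u|.
  move=> tu; apply/proper_card/properP; split.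
    by apply/subsetP => v; rewrite !inE => /ltn_trans; apply.
  by exists t; rewrite !inE ?ltnn.
have rank_inj : injective (fun t => Ordinal (below_lt t)).
  move=> t u /(congr1 val) /= eq_tu; apply: f_inj.
  by case: (ltngtP (f t) (f u)) => // /rank_lt; rewrite eq_tu ltnn.
by exists (perm rank_inj) => t u /rank_lt; rewrite !permE.
Qed.

(** Heights around a cycle can go up and down as prescribed as soon as the
    prescription is not constant: with p ups among the n steps, let each up
    rise by n - p and each down fall by p, so that the total variation
    p (n - p) - (n - p) p vanishes. *)
Lemma cyclic_ups_downs (n : nat) (up : nat -> bool) :
  (exists2 t, t < n & up t) -> (exists2 t, t < n & ~~ up t) ->
  exists s : 'S_n, forall t : 'I_n,
    if up t then s t < s (ordS t) else s (ordS t) < s t.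
Proof.
move=> [tU tUn upU] [tD tDn upD].
pose ups t := \sum_(u < t) up u; pose p := ups n.
have p_gt0 : 0 < p by rewrite /p /ups (bigD1 (Ordinal tUn)) //= upU.
have p_ltn : p < n.
  rewrite -[X in _ < X]card_ord -sum1_card /p /ups.
  rewrite (bigD1 (Ordinal tDn)) //= [X in _ < X](bigD1 (Ordinal tDn)) //=.
  by rewrite (negbTE upD) add0n add1n ltnS; apply: leq_sum => i _; apply: leq_b1.
(* (n - p) ups - p downs = n ups - p t after t steps, shifted by p n to remain
   nonnegative. *)
pose h t := n * ups t + p * (n - t).
have h_closed : h n = h 0 by rewrite /h /ups big_ord0 -/(ups n) -/p; lia.
have h_ordS (t : 'I_n) : h (ordS t) = h t.+1.
  rewrite /=; have [->|neq] := eqVneq t.+1 n; first by rewrite modnn h_closed.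
  by rewrite modn_small // ltn_neqAle neq /=.
have h_step (t : 'I_n) : if up t then h t < h t.+1 else h t.+1 < h t.
  have := ltn_ord t; rewrite /h /ups big_ord_recr /= -/(ups t).
  by case: (up t) => tn; nia.
(* The index t < n, as the lower digit in base n, breaks the ties. *)
pose key (t : 'I_n) := h t * n + t.
have key_inj : injective key.
  move=> t u /(congr1 (modn^~ n)).
  by rewrite /key !modnMDl !modn_small // => /val_inj.
have key_lt (t u : 'I_n) : h t < h u -> key t < key u.
  by rewrite /key => ?; have := ltn_ord t; nia.
have [s s_lt] := perm_of_ranking _ _ key_inj.
exists s => t; have := h_step t.
by case: (up t) => lt_h; apply/s_lt/key_lt; rewrite h_ordS.
Qed.

(** Sorting n points along their first coordinate: point t gets the index
    [r 0 t]. *)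
Lemma dperm_of_rows (d n : nat) (r : 'I_d.+1 -> 'S_n) :
  exists Pi : dperm d.+1 n,
    forall t, dperm_elt Pi (r ord0 t) = [ffun k => r k t].
Proof.
exists [tuple ((r ord0)^-1 * r (lift ord0 k))%g | k < d] => t.
apply/ffunP => k; rewrite !ffunE /dperm_row.
case: (unliftP ord0 k) => [k'|] -> /=; last by rewrite perm1.
by rewrite add0n (nth_map k') ?size_enum_ord ?nth_ord_enum ?permM ?permK.
Qed.

Lemma avoidable_both_signs (d : nat) (P : smp d.+1) :
  rows_have_both_signs P -> avoidable P.
Proof.
move=> /forallP both N.
have [p0 Pp0] : exists p0, p0 \in P.
  by have /andP[/exists_inP[p Pp _] _] := both ord0; exists p.
(* The steps of the walk: each tuple of P once, then p0 until the end. *)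
pose n := N.+1 + #|P|; pose c := nth p0 (enum P).
have Pc t : c t \in P.
  have [lt_t|ge_t] := ltnP t (size (enum P)); last by rewrite /c nth_default.
  by rewrite -mem_enum mem_nth.
have c_onto p : p \in P -> exists2 t, t < n & c t = p.
  rewrite -mem_enum => Pp; exists (index p (enum P)); last exact: nth_index.
  by apply: leq_trans (leq_addl _ _); rewrite cardE index_mem.
have row_ex k : {s : 'S_n |
    [forall t : 'I_n, if c t k then s t < s (ordS t) else s (ordS t) < s t]}.
  apply/sigW; have /andP[/exists_inP[p Pp pk] /exists_inP[q Pq qk]] := both k.
  have [t tn ct] := c_onto p Pp; have [u un cu] := c_onto q Pq.
  have [||s sP] := cyclic_ups_downs n (fun t => c t k).
  - by exists t; rewrite ?ct.
  - by exists u; rewrite ?cu.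
  by exists s; apply/forallP.
pose r k := sval (row_ex k).
have r_step k (t : 'I_n) :
    if c t k then r k t < r k (ordS t) else r k (ordS t) < r k t.
  by have /forallP := svalP (row_ex k); apply.
exists n; first by rewrite /n; lia.
have [Pi PiE] := dperm_of_rows d n r; exists Pi.
apply/existsPn => i; rewrite negbK; apply/existsP.
pose t := ((r ord0)^-1)%g i.
have -> : i = r ord0 t by rewrite permKV.
exists (r ord0 (ordS t)); apply/andP; split.
  by apply/eqP => eq_r; have := r_step ord0 t; rewrite eq_r ltnn if_same.
suff -> : sign_diff (dperm_elt Pi (r ord0 (ordS t))) (dperm_elt Pi (r ord0 t))
          = c t by [].
rewrite !PiE; apply/ffunP => k; rewrite !ffunE.
by have := r_step k t; case: (c t k) => // /ltnW; rewrite leqNgt => /negbTE.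
Qed.

Theorem theorem4 (d : nat) (hd : 2 <= d) (P : smp d) :
  (rank P = None -> strongly_unavoidable P) /\
  ((exists r : nat, rank P = Some r) -> avoidable P).
Proof.
have rankE := rank_finite _ P; split => [rankP | [r rankP]].
  by apply: strongly_unavoidable_missing_sign; rewrite -rankE rankP.
case: d hd P rankE rankP => // d _ P rankE rankP.
by apply: avoidable_both_signs; rewrite -rankE rankP.
Qed.
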